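(* Let $q\ge 3$ be a power of a prime $p$. The singular points of the DGZ curve are exactly the points lying in $PG(2,\mathbb{F}_{q^2})\setminus PG(2,\mathbb{F}_q)$.
   Context: Put $D_1(x,y,z)=\begin{vmatrix} x & x^q & x^{q^3}\\ y & y^q & y^{q^3}\\ z & z^q & z^{q^3}\end{vmatrix}$, $D_2(x,y,z)=\begin{vmatrix} x & x^q & x^{q^2}\\ y & y^q & y^{q^2}\\ z & z^q & z^{q^2}\end{vmatrix}$ and $F=D_1/D_2$, which is a homogeneous polynomial of degree $q^3-q^2$ over $\mathbb{F}_q$. The DGZ curve is the plane curve in $PG(2,\overline{\mathbb{F}}_q)$ with equation $F(x,y,z)=0$. Singular points are points of the curve, over $\overline{\mathbb{F}}_q$, of multiplicity at least $2$. *)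

(* Defs.v *)
From mathcomp Require Export all_boot all_order all_algebra all_field.
From mathcomp Require Export mpoly.
From mathcomp Require ring zify.

Set Implicit Arguments.
Unset Strict Implicit.
Unset Printing Implicit Defensive.

Import GRing.Theory.

Local Open Scope ring_scope.

(* With q = #|F|, the determinant whose row for each coordinate u is
   (u^(q^a), u^(q^b), u^(q^c)). *)
Definition frobenius_det (F : finFieldType) (a b c : nat) : {mpoly F[3]} :=
  \det (\matrix_(i < 3, j < 3)
          ('X_i : {mpoly F[3]}) ^+ (#|F| ^ nth 0 [:: a; b; c] j)%N).

Definition D1 (F : finFieldType) : {mpoly F[3]} := frobenius_det F 0 1 3.
Definition D2 (F : finFieldType) : {mpoly F[3]} := frobenius_det F 0 1 2.

Section Divisibility.

Import ring zify.

Lemma det_mx33 (R : comNzRingType) (f : nat -> nat -> R) :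
  \det (\matrix_(i < 3, j < 3) f i j) =
    f 2 2 * (f 0 0 * f 1 1 - f 0 1 * f 1 0)
    - f 2 1 * (f 0 0 * f 1 2 - f 0 2 * f 1 0)
    + f 2 0 * (f 0 1 * f 1 2 - f 0 2 * f 1 1).
Proof.
rewrite (expand_det_row _ ord0) !big_ord_recl big_ord0.
rewrite /cofactor !(expand_det_row _ ord0) !big_ord_recl !big_ord0.
rewrite /cofactor !det_mx11 !mxE /= /bump /= ?addn0 ?add0n !addnE /=.
by ring.
Qed.

Lemma dvd_moore2 (R : comNzRingType) (x y : R) (q : nat) : (0 < q)%N ->
  exists s, x * y ^+ (q ^ 2) - x ^+ (q ^ 2) * y = (x * y ^+ q - x ^+ q * y) * s.
Proof.
case: q => // q _.
have -> : (q.+1 ^ 2 = (q * q.+2).+1)%N by rewrite !mulnS expnS expn1; lia.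
rewrite !exprS !exprM.
exists (\sum_(i < q.+2) (y ^+ q) ^+ (q.+2.-1 - i) * (x ^+ q) ^+ i).
have := subrXX (y ^+ q) (x ^+ q) q.+2.
move: ((y ^+ q) ^+ q.+2) ((x ^+ q) ^+ q.+2) (\sum_(i < _) _) => u v s uvs.
rewrite (_ : x * (y * u) - _ = x * y * (u - v)); last by ring.
by rewrite uvs; ring.
Qed.

Lemma moore_quotient (R : idomainType) (q : nat) (x y z : R) :
    (0 < q)%N ->
    (forall u v : R, (u + v) ^+ q = u ^+ q + v ^+ q) ->
    (forall u : R, (- u) ^+ q = - u ^+ q) ->
  exists G, G * (z ^+ (q ^ 2) * (x * y ^+ q - x ^+ q * y)
                 - z ^+ q * (x * y ^+ (q ^ 2) - x ^+ (q ^ 2) * y)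
                 + z * (x ^+ q * y ^+ (q ^ 2) - x ^+ (q ^ 2) * y ^+ q)) =
    z ^+ (q ^ 3) * (x * y ^+ q - x ^+ q * y)
    - z ^+ q * (x * y ^+ (q ^ 3) - x ^+ (q ^ 3) * y)
    + z * (x ^+ q * y ^+ (q ^ 3) - x ^+ (q ^ 3) * y ^+ q).
Proof.
move=> q0 frD frN.
have [s] := dvd_moore2 x y q0.
have fr2 (u : R) : u ^+ (q ^ 2) = (u ^+ q) ^+ q by rewrite -exprM mulnn.
have fr3 (u : R) : u ^+ (q ^ 3) = ((u ^+ q) ^+ q) ^+ q.
  by rewrite -!exprM !expnS expn0 muln1 ?mulnA.
have fr0 : (0 : R) ^+ q = 0 by rewrite expr0n gtn_eqF.
rewrite !{}fr2 !{}fr3.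
set x1 := x ^+ q; set x2 := x1 ^+ q; set x3 := x2 ^+ q.
set y1 := y ^+ q; set y2 := y1 ^+ q; set y3 := y2 ^+ q.
set z1 := z ^+ q; set z2 := z1 ^+ q; set z3 := z2 ^+ q.
set d := x * y1 - x1 * y => sE.
have dq : d ^+ q = x1 * y2 - x2 * y1 by rewrite frD frN !exprMn.
have dqq : (d ^+ q) ^+ q = x2 * y3 - x3 * y2.
  by rewrite dq frD frN !exprMn.
have sq : x1 * y3 - x3 * y1 = d ^+ q * s ^+ q.
  by rewrite -[RHS]exprMn -sE frD frN !exprMn.
have dS : d ^+ q = d * d ^+ q.-1 by rewrite -exprS prednK.
set r := d ^+ q.-1 in dS.
have drq : d ^+ q * r ^+ q = x2 * y3 - x3 * y2 by rewrite -[LHS]exprMn -dS dqq.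
have eE : (x * y3 - x3 * y) * d ^+ q = d * (s * s ^+ q - r ^+ q) * d ^+ q.
  transitivity (d * s * (d ^+ q * s ^+ q) - d * (d ^+ q * r ^+ q)).
    by rewrite drq -sE -sq dq /d; ring.
  by ring.
have [d0 | dn0] := eqVneq d 0.
  exists 1; rewrite mul1r -dq sq sE d0.
  have e0 : x * y3 = x3 * y.
    move/eqP: d0; rewrite subr_eq0 => /eqP h.
    have [x0|xn0] := eqVneq x 0.
      by rewrite /x3 /x2 /x1 x0 !fr0 !mul0r.
    apply/(mulfI xn0).
    have h1 : x1 * y2 = x2 * y1 by rewrite -!exprMn h.
    have h2 : x2 * y3 = x3 * y2 by rewrite -!exprMn h.
    have x1n0 : x1 != 0 by rewrite expf_neq0.
    have x2n0 : x2 != 0 by rewrite expf_neq0.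
    apply/(mulfI x1n0); apply/(mulfI x2n0).
    transitivity (x * x * x1 * (x2 * y3)); first by ring.
    rewrite h2; transitivity (x * x * x3 * (x1 * y2)); first by ring.
    rewrite h1; transitivity (x * x2 * x3 * (x * y1)); first by ring.
    by rewrite h; ring.
  by rewrite e0 fr0 subrr !(mul0r, mulr0).
exists ((z2 - z1 * s + z * r) ^+ q.-1 + s ^+ q).
have {}eE := mulIf (expf_neq0 q dn0) eE.
rewrite eE sq sE -dq dS.
set L := z2 - z1 * s + z * r.
have LE : L * L ^+ q.-1 = z3 - z2 * s ^+ q + z1 * r ^+ q.
  by rewrite -exprS prednK // /L !frD frN !exprMn.
rewrite (_ : z2 * d - _ + _ = d * L); last by rewrite /L; ring.
transitivity (d * (L * L ^+ q.-1) + d * L * s ^+ q); first by ring.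
by rewrite LE /L; ring.
Qed.

Lemma D2_dvd_D1 (F : finFieldType) : exists G : {mpoly F[3]}, G * D2 F == D1 F.
Proof.
have [p p_pr pF] := finPcharP F.
have q_nat : [pchar {mpoly F[3]}].-nat #|F|.
  have -> : #|F| = (p ^ logn p #|F|)%N := card_pprimeChar pF.
  by rewrite pnatX; apply/orP; left; rewrite pnatE // (pchar_lalg {mpoly F[3]}).
pose f a b c (k l : nat) : {mpoly F[3]} :=
  'X_(inord k) ^+ (#|F| ^ nth 0 [:: a; b; c] l)%N.
have detE a b c : frobenius_det F a b c = \det (\matrix_(i < 3, j < 3) f a b c i j).
  by congr (\det _); apply/matrixP => i j; rewrite !mxE /f inord_val.
have q0 : (0 < #|F|)%N by apply/card_gt0P; exists 0.
have frN (u : {mpoly F[3]}) : (- u) ^+ #|F| = - u ^+ #|F|.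
  by apply/eqP; rewrite -addr_eq0 -exprDn_pchar // addNr expr0n gtn_eqF.
have [G GE] := moore_quotient ('X_(inord 0) : {mpoly F[3]}) 'X_(inord 1)
  'X_(inord 2) q0 (fun u v => exprDn_pchar u v q_nat) frN.
exists G; apply/eqP; rewrite /D1 /D2 !detE.
rewrite (det_mx33 (f 0 1 2)%N) (det_mx33 (f 0 1 3)%N) /f.
by rewrite !expn0 !expn1 !expr1.
Qed.

End Divisibility.

(* The exact quotient D1 / D2 in F_q[x, y, z] (unique, as D2 != 0), which
   defines the DGZ curve. *)
Definition dgz (F : finFieldType) : {mpoly F[3]} := xchoose (D2_dvd_D1 F).

Lemma dgzE (F : finFieldType) : dgz F * D2 F = D1 F.
Proof. exact/eqP/(xchooseP (D2_dvd_D1 F)). Qed.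

(* Least total degree of a monomial of f (0 when f = 0). *)
Definition mpoly_order (n : nat) (R : nzRingType) (f : {mpoly R[n]}) : nat :=
  \big[minn/msize f]_(m <- msupp f) mdeg m.

(* Points of PG(2, K) are given by homogeneous coordinates: a nonzero v, up to
   a nonzero scalar.  [local_eq G v i] is the equation of G = 0 in the affine
   chart x_i = 1, translated so that the point v is at the origin; the variable
   'X_i does not occur in it. *)
Definition local_eq (K : fieldType) (G : {mpoly K[3]}) (v : 'rV[K]_3)
    (i : 'I_3) : {mpoly K[3]} :=
  G \mPo [tuple (v 0 j / v 0 i)%:MP + (if j == i then 0 else 'X_j) | j < 3].

(* Multiplicity of the point v on the curve G = 0, G homogeneous; it does not
   depend on which nonzero coordinate of v is picked. *)
Definition multiplicity (K : fieldType) (G : {mpoly K[3]}) (v : 'rV[K]_3) :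
    nat :=
  if [pick i | v 0 i != 0] is Some i then mpoly_order (local_eq G v i) else 0%N.

Definition on_curve (K : fieldType) (G : {mpoly K[3]}) (v : 'rV[K]_3) : Prop :=
  G.@[fun i => v 0 i] = 0.

Definition singular_point (K : fieldType) (G : {mpoly K[3]}) (v : 'rV[K]_3) :
    Prop :=
  on_curve G v /\ (2 <= multiplicity G v)%N.

(* The point v of PG(2, K) lies in PG(2, k), k being embedded in K by f. *)
Definition in_PG2 (k K : fieldType) (f : {rmorphism k -> K}) (v : 'rV[K]_3) :
    Prop :=
  exists (w : 'rV[k]_3) (c : K), c != 0 /\ v = c *: map_mx f w.

(* Main.v *)
(* With L_V(z) = prod_(v in V) (z - v) for an F_q-space V, additivity of L_<x>
   gives L_<x,y> = L_<L_<x>(y)> o L_<x>.  Writing this q-polynomial as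
   z^(q^2) - s z^q + r z with s = (x y^(q^2) - x^(q^2) y) / (x y^q - x^q y) and
   applying the column operations that it dictates to D1 and D2 yields
   F = L_<x,y>(z)^(q-1) + s^q.  Moreover F is invariant under GL_3(F_q).
   If D2(v) <> 0, differentiating D1 = F D2 at a singular point v shows that v
   is proportional to v^(q^2), hence D2(v) = 0: a contradiction.  If D2(v) = 0,
   then v lies on an F_q-line, which may be taken to be z = 0; there L vanishes,
   so F = s^q, and since q - 1 >= 2 every zero of s on that line is singular.
   Those zeros are the points of PG(1, q^2) not in PG(1, q). *)
Require Import Defs.
From mathcomp Require Import ring.

Set Implicit Arguments.
Unset Strict Implicit.
Unset Printing Implicit Defensive.

Import GRing.Theory.

Local Open Scope ring_scope.

(** * The q-polynomials of F_q-spans and the factorisation of Moore determinants *)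

Section MooreTower.

Variables (R : comNzRingType) (q : nat).
Hypotheses (q_gt0 : (0 < q)%N) (qR : [pchar R].-nat q).

Implicit Types x y z : R.

Let frD x y : (x + y) ^+ q = x ^+ q + y ^+ q. Proof. exact: exprDn_pchar. Qed.
Let frN x : (- x) ^+ q = - x ^+ q. Proof. exact: exprNn_pchar. Qed.
Let exprqq x : x ^+ (q ^ 2) = (x ^+ q) ^+ q. Proof. by rewrite -exprM mulnn. Qed.
Let exprqqq x : x ^+ (q ^ 3) = ((x ^+ q) ^+ q) ^+ q.
Proof. by rewrite -!exprM (expnS q 2) mulnA mulnn. Qed.

(* The monic q-polynomial in [y] whose roots are the F_q-multiples of [x]. *)
Definition line_poly x y := y ^+ q - x ^+ q.-1 * y.

(* The monic q-polynomial in [z] whose roots are the F_q-combinations of [x]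
   and [y]. *)
Definition plane_poly x y z := line_poly (line_poly x y) (line_poly x z).

(* The quotient (x y^(q^2) - x^(q^2) y) / (x y^q - x^q y), see [moore_ratioE]. *)
Definition moore_ratio x y := x ^+ (q * q.-1) + line_poly x y ^+ q.-1.

(** The determinant with rows [(u, u^q, u^(q^k))] for [u = x, y, z], expanded along the row of
    [z]. *)
Definition moore_det k x y z :=
  z ^+ (q ^ k) * (x * y ^+ q - x ^+ q * y)
  - z ^+ q * (x * y ^+ (q ^ k) - x ^+ (q ^ k) * y)
  + z * (x ^+ q * y ^+ (q ^ k) - x ^+ (q ^ k) * y ^+ q).

Lemma line_polyxx x : line_poly x x = 0.
Proof. by rewrite /line_poly -exprSr prednK ?subrr. Qed.

Lemma line_polyx0 x : line_poly x 0 = 0.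
Proof. by rewrite /line_poly mulr0 expr0n gtn_eqF ?subrr. Qed.

Lemma line_polyE x y : x * line_poly x y = x * y ^+ q - x ^+ q * y.
Proof. by rewrite /line_poly mulrBr mulrA -exprS prednK. Qed.

Lemma plane_polyE x y z :
  plane_poly x y z = z ^+ (q ^ 2) - moore_ratio x y * z ^+ q
                     + (x * line_poly x y) ^+ q.-1 * z.
Proof.
rewrite /plane_poly /moore_ratio {1 3}/line_poly exprqq frD frN !exprMn.
by rewrite -(exprM x) mulnC; ring.
Qed.

(** Since [x] is a root of the q-polynomial [plane_poly x y], its powers satisfy the recurrence with
    these coefficients; the next lemma treats the root [y]. *)
Lemma plane_poly_recl x y :
  x ^+ (q ^ 2) = moore_ratio x y * x ^+ q - (x * line_poly x y) ^+ q.-1 * x.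
Proof.
apply/eqP; rewrite -subr_eq0 opprB addrA addrAC -plane_polyE.
by rewrite /plane_poly line_polyxx line_polyx0.
Qed.

Lemma plane_poly_recr x y :
  y ^+ (q ^ 2) = moore_ratio x y * y ^+ q - (x * line_poly x y) ^+ q.-1 * y.
Proof.
apply/eqP; rewrite -subr_eq0 opprB addrA addrAC -plane_polyE.
by rewrite /plane_poly line_polyxx.
Qed.

Lemma moore_ratioE x y :
  x * line_poly x y * moore_ratio x y = x * y ^+ (q ^ 2) - x ^+ (q ^ 2) * y.
Proof.
by rewrite (plane_poly_recl x y) (plane_poly_recr x y) line_polyE; ring.
Qed.

(** Subtracting the recurrence shared by [x] and [y] from the column of q^2-th powers leaves 0 in
    their rows and [plane_poly x y z] in the row of [z]. *)
Lemma moore_det2E x y z :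
  moore_det 2 x y z = x * line_poly x y * plane_poly x y z.
Proof.
rewrite /moore_det plane_polyE.
by rewrite (plane_poly_recl x y) (plane_poly_recr x y) line_polyE; ring.
Qed.

(* Raising the recurrences to the power q expresses the column of q^3-th powers
   through the columns of q-th and q^2-th powers. *)
Lemma moore_det3E x y z :
  moore_det 3 x y z =
    (plane_poly x y z ^+ q.-1 + moore_ratio x y ^+ q) * moore_det 2 x y z.
Proof.
(* By [moore_det2E] the first summand becomes [x y^q - x^q y] times the full q-th power of
   [plane_poly x y z], which additivity expands. *)
rewrite mulrDl {1}moore_det2E mulrCA -exprSr prednK // line_polyE.
set s := moore_ratio x y; set r := (x * line_poly x y) ^+ q.-1.
have E (u : R) : u ^+ (q ^ 2) = s * u ^+ q - r * u ->
    u ^+ (q ^ 3) = s ^+ q * u ^+ (q ^ 2) - r ^+ q * u ^+ q.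
  by rewrite exprqqq -(exprqq u) => {1}->; rewrite frD frN !exprMn -exprqq.
have Ex := E x (plane_poly_recl x y); have Ey := E y (plane_poly_recr x y).
have -> : plane_poly x y z ^+ q =
    z ^+ (q ^ 3) - s ^+ q * z ^+ (q ^ 2) + r ^+ q * z ^+ q.
  have -> : plane_poly x y z = z ^+ (q ^ 2) - s * z ^+ q + r * z.
    exact: plane_polyE.
  by clearbody s r; rewrite !frD frN !exprMn exprqqq -(exprqq z).
rewrite /moore_det Ex Ey.
by ring.
Qed.

End MooreTower.

(** * Evaluation of the determinants and q-polynomials along ring morphisms *)

Lemma pnat_card_rmorph (F : finFieldType) (R : nzRingType) (f : {rmorphism F -> R}) :
  [pchar R].-nat #|F|.
Proof.
have [p p_pr pF] := finPcharP F.
have -> : #|F| = (p ^ logn p #|F|)%N := card_pprimeChar pF.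
by rewrite pnatX pnatE // (rmorph_pchar f pF).
Qed.

Section Evaluation.

Variables (F : finFieldType) (R : comNzRingType) (f : {rmorphism F -> R}).

(** Coordinate 0 takes the place of [z]; a cyclic rotation of the three rows is even, so no sign
    appears. *)
Lemma mmap_frobenius_det k (h : 'I_3 -> R) :
  mmap f h (frobenius_det F 0 1 k) = moore_det #|F| k (h 1) (h 2) (h 0).
Proof.
rewrite /frobenius_det -det_map_mx.
pose g i j := h (inord i) ^+ (#|F| ^ nth 0 [:: 0; 1; k] j)%N.
have -> : map_mx (mmap f h) (\matrix_(i < 3, j < 3)
    ('X_i : {mpoly F[3]}) ^+ (#|F| ^ nth 0 [:: 0; 1; k] j)%N) =
    \matrix_(i < 3, j < 3) g i j.
  by apply/matrixP => i j; rewrite !mxE /g inord_val rmorphXn /= mmapX mmap1U.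
have I (i : 'I_3) : inord i = i by rewrite inord_val.
rewrite det_mx33 /g /= (I 0) (I 1) (I 2) !expn0 !expn1 !expr1.
by rewrite /moore_det; ring.
Qed.

Lemma mmap_dgz_D2 (h : 'I_3 -> R) :
  mmap f h (dgz F) * moore_det #|F| 2 (h 1) (h 2) (h 0) =
    moore_det #|F| 3 (h 1) (h 2) (h 0).
Proof. by rewrite -!mmap_frobenius_det -[RHS](congr1 _ (dgzE F)) rmorphM. Qed.

End Evaluation.

Section MmapComposition.

Variables (n : nat) (R : nzRingType) (S T : comNzRingType).

Lemma rmorph_mmap (phi : {rmorphism S -> T}) (f : {rmorphism R -> S})
    (h : 'I_n -> S) (P : {mpoly R[n]}) :
  phi (mmap f h P) = mmap (phi \o f) (phi \o h) P.
Proof.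
rewrite /mmap rmorph_sum /=; apply: eq_bigr => m _.
rewrite rmorphM /= /mmap1 rmorph_prod /=; congr (_ * _).
by apply: eq_bigr => i _; rewrite rmorphXn.
Qed.

Lemma eq_mmap (f g : R -> S) (h k : 'I_n -> S) (P : {mpoly R[n]}) :
  f =1 g -> h =1 k -> mmap f h P = mmap g k P.
Proof.
move=> fg hk; apply: eq_bigr => m _; rewrite fg; congr (_ * _).
exact: mmap1_eq.
Qed.

End MmapComposition.

Lemma mmap_mpolyX (n : nat) (R : nzRingType) (P : {mpoly R[n]}) :
  mmap (@mpolyC n R) (fun i => 'X_i) P = P.
Proof.
rewrite [RHS]mpolyE; apply: eq_bigr => m _.
by rewrite mmap1_id mul_mpolyC.
Qed.

Section RmorphTower.

Variables (R S : comNzRingType) (phi : {rmorphism R -> S}) (q : nat).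

Lemma rmorph_line_poly x y : phi (line_poly q x y) = line_poly q (phi x) (phi y).
Proof. by rewrite rmorphB rmorphM !rmorphXn. Qed.

Lemma rmorph_plane_poly x y z :
  phi (plane_poly q x y z) = plane_poly q (phi x) (phi y) (phi z).
Proof. by rewrite /plane_poly !rmorph_line_poly. Qed.

Lemma rmorph_moore_ratio x y :
  phi (moore_ratio q x y) = moore_ratio q (phi x) (phi y).
Proof. by rewrite rmorphD !rmorphXn rmorph_line_poly. Qed.

End RmorphTower.

(** * Closed formula for the curve and invariance under GL_3(F_q) *)

Section DGZ.

Variable F : finFieldType.

Let q := #|F|.
Let q_gt1 : (1 < q)%N. Proof. exact: finNzRing_gt1. Qed.
Let q_gt0 : (0 < q)%N. Proof. exact: ltnW. Qed.

Lemma frobenius_detE k :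
  frobenius_det F 0 1 k = moore_det q k 'X_1 'X_2 'X_0.
Proof. by rewrite -[LHS]mmap_mpolyX mmap_frobenius_det. Qed.

(** Each of the three factors given by [moore_det2E] takes the value 1 at an explicit point. *)
Lemma D2_neq0 : D2 F != 0.
Proof.
rewrite /D2 frobenius_detE moore_det2E //; last exact: (pnat_card_rmorph (@mpolyC 3 F)).
have nz (P : {mpoly F[3]}) (h : 'I_3 -> F) : P.@[h] = 1 -> P != 0.
  by move=> P1; apply/eqP => P0; move/eqP: P1; rewrite P0 meval0 eq_sym oner_eq0.
rewrite !mulf_neq0 //.
- by apply: (nz _ (fun=> 1)); rewrite mevalXU.
- apply: (nz _ (fun i => (i == 2)%:R)).
  rewrite rmorph_line_poly /= !mevalXU /line_poly /=.
  by rewrite expr1n expr0n -subn1 subn_eq0 leqNgt q_gt1 mul0r subr0.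
- apply: (nz _ (fun i => (i == 0)%:R)).
  rewrite rmorph_plane_poly /= !mevalXU /plane_poly /line_poly /=.
  rewrite !mulr0 !expr1n !expr0n -subn1 subn_eq0 (gtn_eqF q_gt0) subr0.
  by rewrite leqNgt q_gt1 expr0n subn_eq0 leqNgt q_gt1 !mul0r !subr0 expr1n.
Qed.

Lemma dgz_tower : dgz F =
  plane_poly q 'X_1 'X_2 'X_0 ^+ q.-1 + moore_ratio q 'X_1 'X_2 ^+ q.
Proof.
apply/(mulIf D2_neq0); rewrite dgzE /D1 /D2 !frobenius_detE.
by apply: moore_det3E => //; exact: (pnat_card_rmorph (@mpolyC 3 F)).
Qed.

Lemma mmap_dgzE (R : comNzRingType) (f : {rmorphism F -> R}) (h : 'I_3 -> R) :
  mmap f h (dgz F) =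
    plane_poly q (h 1) (h 2) (h 0) ^+ q.-1 + moore_ratio q (h 1) (h 2) ^+ q.
Proof.
rewrite dgz_tower rmorphD !rmorphXn /= rmorph_plane_poly rmorph_moore_ratio.
by rewrite /= !mmapX !mmap1U.
Qed.

Lemma expf_cardX (a : F) e : a ^+ (q ^ e) = a.
Proof. by elim: e => [|e IHe]; rewrite ?expr1 // expnSr exprM IHe expf_card. Qed.

Definition linear_change (R : nzRingType) (f : F -> R) (A : 'M[F]_3) (h : 'I_3 -> R)
  (i : 'I_3) : R := \sum_j h j * f (A j i).

(** The entries of [A] are fixed by the q-power map, so the substitution multiplies both [D1] and
    [D2] by [\det A]. *)
Lemma dgz_linear_change (R : comNzRingType) (f : {rmorphism F -> R})
    (A : 'M[F]_3) (h : 'I_3 -> R) : A \in unitmx ->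
  mmap f (linear_change f A h) (dgz F) = mmap f h (dgz F).
Proof.
move=> Au; pose C : {rmorphism F -> {mpoly F[3]}} := @mpolyC 3 F.
pose X i : {mpoly F[3]} := 'X_i.
have detA k : mmap C (linear_change C A X) (frobenius_det F 0 1 k) =
    C (\det A) * frobenius_det F 0 1 k.
  rewrite /frobenius_det -!det_map_mx -[X in X * _]det_tr -det_mulmx; congr (\det _).
  apply/matrixP => i j; rewrite !mxE rmorphXn /= mmapX mmap1U.
  set Q := (q ^ _)%N.
  have frD : {morph (fun u : {mpoly F[3]} => u ^+ Q) : u v / u + v}.
    move=> u v; apply: exprDn_pchar.
    by rewrite pnatX (pnat_card_rmorph (@mpolyC 3 F)).
  rewrite (big_morph _ frD (_ : _ = 0)).
    apply: eq_bigr => l _; by rewrite !mxE exprMn -rmorphXn expf_cardX mulrC.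
  by rewrite expr0n gtn_eqF // expn_gt0 q_gt0.
have E : mmap C (linear_change C A X) (dgz F) = dgz F.
  have dA0 : C (\det A) != 0.
    by rewrite mpolyC_eq0 -unitfE -unitmxE.
  apply/(mulIf D2_neq0)/(mulfI dA0); rewrite mulrCA.
  rewrite -[in LHS]detA -rmorphM -/(D2 F) /= [_ * D2 F in LHS]dgzE [in RHS]dgzE.
  exact: detA.
(* The identity [E] at the generic point specialises to any [h]. *)
rewrite -[in RHS]E rmorph_mmap; apply: eq_mmap => i /=.
  by rewrite mmapC.
rewrite rmorph_sum; apply: eq_bigr => j _.
by rewrite rmorphM /= mmapX mmap1U mmapC.
Qed.

End DGZ.

(** * The order of a polynomial at the origin, tested on lines *)

Section Order.

Variables (n : nat) (K : fieldType).
Implicit Types (P : {mpoly K[n]}) (w : 'I_n -> K).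

Lemma mmap_lineE P w :
  mmap (@polyC K) (fun i => (w i)%:P * 'X) P =
    \sum_(m <- msupp P) (P@_m * \prod_i w i ^+ m i) *: 'X^(mdeg m).
Proof.
apply: eq_bigr => m _; rewrite /mmap1 mul_polyC -scalerA; congr (_ *: _).
rewrite -mul_polyC rmorph_prod mdegE -prodrXr -big_split /=.
by apply: eq_bigr => i _; rewrite exprMn -rmorphXn.
Qed.

Lemma mpoly_order_ge k P :
  (k <= mpoly_order P)%N = (k <= msize P)%N && all (fun m => k <= mdeg m)%N (msupp P).
Proof.
rewrite /mpoly_order; elim: (msupp P) => [|m s IHs]; first by rewrite big_nil andbT.
by rewrite big_cons leq_min IHs /= andbCA.
Qed.

Lemma mpoly_order_ge2_dvd P w : (2 <= mpoly_order P)%N ->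
  'X^2 %| mmap (@polyC K) (fun i => (w i)%:P * 'X) P.
Proof.
rewrite mpoly_order_ge mmap_lineE => /andP[_ /allP Pge2]; rewrite big_seq.
apply: (big_ind (fun p => 'X^2 %| p)) => [|p r|m /Pge2 m2];
  [exact: dvdp0 | exact: dvdp_add |].
by rewrite -mul_polyC dvdp_mull // dvdp_exp2l.
Qed.

(** Lines through the origin detect the constant and linear terms. The zero polynomial has order 0,
    hence the first hypothesis. *)
Lemma dvd_mpoly_order_ge2 P : P != 0 ->
    (forall w, 'X^2 %| mmap (@polyC K) (fun i => (w i)%:P * 'X) P) ->
  (2 <= mpoly_order P)%N.
Proof.
move=> P0 PX2.
have Pge2 : all (fun m => 2 <= mdeg m)%N (msupp P).
  apply/allP => m0 m0P; rewrite leqNgt; apply/negP => m0_lt2.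
  (* The direction is the exponent vector of [m0]: zero for the constant term, a basis vector for a
     variable. No other monomial then contributes in degree [mdeg m0]. *)
  have /dvdpP[r rE] := PX2 (fun i => (m0 i)%:R).
  have := congr1 (fun p : {poly K} => p`_(mdeg m0)) rE.
  rewrite /= coefMXn m0_lt2 mmap_lineE coef_sum => /eqP.
  rewrite (bigD1_seq m0) ?msupp_uniq //= [X in _ + X]big1_seq ?addr0
    => [|m /andP[m_m0 mP]].
    rewrite coefZ coefXn eqxx mulr1 mulf_eq0 mcoeff_eq0 m0P /=; apply/negP.
    apply/prodf_neq0 => i _; case: (posnP (m0 i)) => [->|].
      by rewrite expr0 oner_eq0.
    have : (m0 i <= mdeg m0)%N by rewrite mdegE (bigD1 i) //= leq_addr.
    case: (m0 i) => [|[|k]] // h _; first by rewrite expr1 oner_eq0.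
    by move: m0_lt2; rewrite ltnNge (leq_trans _ h).
  rewrite coefZ coefXn; case: eqP => [mE|]; last by rewrite mulr0.
  suff -> : \prod_i (m0 i)%:R ^+ m i = 0 :> K by rewrite mulr0 mul0r.
  have : (mdeg m0 == 0%N) || (mdeg m0 == 1%N) by case: (mdeg m0) m0_lt2 => [|[]].
  case/orP => [m00|/[dup] m01 /mdeg1P[i /eqP m0i]].
    move: m00 (m00) m_m0; rewrite {1}mE !mdeg_eq0 => /eqP -> /eqP ->.
    by rewrite eqxx.
  move: m01 m_m0; rewrite mE => /mdeg1P[j /eqP ->]; rewrite m0i => ji.
  rewrite (bigD1 j) //= !mnm1E eqxx expr1.
  by move: ji; rewrite eq_mnm1 eq_sym => /negPf ->; rewrite mul0r.
rewrite mpoly_order_ge Pge2 andbT.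
have mP := mlead_supp P0.
exact: leq_trans (allP Pge2 _ mP) (ltnW (msize_mdeg_lt mP)).
Qed.

End Order.

(** * Affine charts and restriction to lines *)

Section Charts.

Variables (F : finFieldType) (K : fieldType) (iota : {rmorphism F -> K}).
Implicit Types (P : {mpoly F[3]}) (u v w : 'rV[K]_3).

Definition line_eval P u w : {poly K} :=
  mmap (polyC \o iota) (fun j => (u 0 j)%:P + (w 0 j)%:P * 'X) P.

Lemma line_eval_horner P u w t : (line_eval P u w).[t] = mmap iota ((u + t *: w) 0) P.
Proof.
rewrite -[LHS]/(horner_eval t _) rmorph_mmap.
by apply: eq_mmap => [a|j] /=; rewrite /horner_eval ?mxE !hornerE // mulrC.
Qed.

Lemma meval_map_mpoly P (h : 'I_3 -> K) : (map_mpoly iota P).@[h] = mmap iota h P.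
Proof.
rewrite /map_mpoly rmorph_mmap; apply: eq_mmap => [a|i] /=; first exact: mevalC.
exact: mevalXU.
Qed.

(** The i-th coordinate of the direction is 0 because ['X_i] does not occur in the chart. *)
Lemma mmap_local_eq P v i (w : 'I_3 -> K) :
  mmap (@polyC K) (fun j => (w j)%:P * 'X) (local_eq (map_mpoly iota P) v i) =
    line_eval P ((v 0 i)^-1 *: v) (\row_j if j == i then 0 else w j).
Proof.
rewrite /local_eq /comp_mpoly rmorph_mmap /map_mpoly rmorph_mmap.
apply: eq_mmap => [a|j] /=; first by rewrite mmapC /= mmapC.
rewrite mmapX mmap1U /= tnth_mktuple rmorphD /= mmapC !mxE mulrC; congr (_ + _).
by case: eqP => _; rewrite ?mmap0 ?mul0r ?mmapX ?mmap1U.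
Qed.

(** Serves to show that no local equation is zero: the chart [x_i = 1] contains this point. *)
Lemma dgz_coordinate_point i : mmap iota ((delta_mx 0 i : 'rV[K]_3) 0) (dgz F) = 1.
Proof.
have q_gt1 : (1 < #|F|)%N := finNzRing_gt1 F.
have q1_gt0 : (0 < #|F|.-1)%N by rewrite -subn1 subn_gt0.
have [q0 q10] : #|F| != 0%N /\ #|F|.-1 != 0%N by rewrite -!lt0n q1_gt0 ltnW.
rewrite mmap_dgzE !mxE /= /plane_poly /moore_ratio /line_poly.
have [z1 z2 z3] : [/\ 0 ^+ #|F| = 0 :> K, 0 ^+ #|F|.-1 = 0 :> K
    & 0 ^+ (#|F| * #|F|.-1) = 0 :> K].
  by rewrite !expr0n muln_eq0 (negPf q0) (negPf q10).
case: i => [[|[|[|//]]] lti] /=; by rewrite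
  !(z1, z2, z3, expr1n, mulr0, mul0r, subr0, sub0r, oppr0, add0r, addr0).
Qed.

Lemma mpoly_order_local_dgz v i : v 0 i != 0 ->
  (2 <= mpoly_order (local_eq (map_mpoly iota (dgz F)) v i))%N <->
  forall w, w 0 i = 0 -> 'X^2 %| line_eval (dgz F) ((v 0 i)^-1 *: v) w.
Proof.
move=> vi; set u := (v 0 i)^-1 *: v.
have ui : u 0 i = 1 by rewrite mxE mulVf.
have locE (w : 'rV_3) : w 0 i = 0 ->
    mmap (@polyC K) (fun j => (w 0 j)%:P * 'X)
      (local_eq (map_mpoly iota (dgz F)) v i) = line_eval (dgz F) u w.
  move=> wi; rewrite mmap_local_eq -/u; congr line_eval; apply/rowP => j.
  by rewrite mxE; case: eqP => // ->.
split=> [ge2 w wi | ldvd].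
  by rewrite -locE //; exact: mpoly_order_ge2_dvd.
apply: dvd_mpoly_order_ge2 => [|w]; last first.
  by rewrite mmap_local_eq; apply: ldvd; rewrite mxE eqxx.
(* This direction joins [u] to the i-th coordinate point inside the chart; that point is reached at
   parameter 1. *)
apply/eqP => loc0; pose w := delta_mx 0 i - u.
have wi : w 0 i = 0 by rewrite mxE [X in _ + X]mxE ui mxE !eqxx subrr.
have := locE _ wi; rewrite loc0 mmap0.
move/(congr1 (horner^~ 1)); rewrite line_eval_horner scale1r addrC subrK horner0.
by move/eqP; rewrite dgz_coordinate_point eq_sym oner_eq0.
Qed.

End Charts.

(** * Rational points as fixed points of Frobenius *)

Section FixedField.

Variables (F : finFieldType) (K : fieldType) (iota : {rmorphism F -> K}).

(** The polynomial [X^q - X] is the product of the [X - a] for [a] in [F], so it has no further root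
    in [K]. *)
Lemma finField_fixedP (x : K) : x ^+ #|F| = x -> exists a, x = iota a.
Proof.
move=> xq; have := congr1 (map_poly iota) (finField_genPoly F).
rewrite rmorphB rmorphXn /= map_polyX rmorph_prod => /(congr1 (horner^~ x)).
rewrite !hornerE xq subrr horner_prod => /esym/eqP/prodf_eq0[a _].
by rewrite rmorphB /= map_polyX map_polyC !hornerE subr_eq0 => /eqP ->; exists a.
Qed.

(* [v] is proportional to its image under the Q-power map, i.e. it is zero or a
   point fixed by that map. *)
Definition frobenius_fixed Q (v : 'rV[K]_3) :=
  forall i j, v 0 i * v 0 j ^+ Q = v 0 i ^+ Q * v 0 j.

Lemma frobenius_fixedZ Q c v : frobenius_fixed Q v -> frobenius_fixed Q (c *: v).
Proof.
by move=> vQ i j; rewrite !mxE !exprMn mulrACA vQ; ring.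
Qed.

(** Division by a nonzero coordinate turns proportionality into invariance of every ratio
    [v_j / v_i]. *)
Lemma in_PG2P v : v != 0 -> in_PG2 iota v <-> frobenius_fixed #|F| v.
Proof.
move=> v0; split=> [[w [c [_ ->]]] | vq].
  apply: frobenius_fixedZ => i j.
  by rewrite !mxE -!rmorphXn !expf_card.
have [i vi] : exists i, v 0 i != 0.
  by apply/rV0Pn.
have /fin_all_exists[w wE] j : exists a, v 0 j / v 0 i = iota a.
  apply: finField_fixedP; rewrite expr_div_n.
  apply/eqP; rewrite eqr_div ?expf_neq0 //.
  by rewrite mulrC vq mulrC.
exists (\row_j w j), (v 0 i); split=> //; apply/rowP => j.
by rewrite !mxE -wE mulrC divfK.
Qed.

Lemma frobenius_fixed_change e (A : 'M[F]_3) v :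
  frobenius_fixed (#|F| ^ e) v ->
  frobenius_fixed (#|F| ^ e) (v *m map_mx iota A).
Proof.
set Q := (_ ^ _)%N => vQ i j.
have frD : {morph (fun u : K => u ^+ Q) : x y / x + y}.
  by move=> x y; apply: exprDn_pchar; rewrite pnatX (pnat_card_rmorph iota).
have fr0 : (0 : K) ^+ Q = 0 by rewrite expr0n gtn_eqF // expn_gt0 ltnW ?finNzRing_gt1.
have frM l : (\sum_k v 0 k * iota (A k l)) ^+ Q = \sum_k v 0 k ^+ Q * iota (A k l).
  rewrite (big_morph _ frD fr0); apply: eq_bigr => k _.
  by rewrite exprMn -rmorphXn expf_cardX.
have uE l : (v *m map_mx iota A) 0 l = \sum_k v 0 k * iota (A k l).
  by rewrite mxE; apply: eq_bigr => k _; rewrite mxE.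
rewrite !uE !frM !big_distrlr /=; apply: eq_bigr => k _; apply: eq_bigr => l _.
by rewrite mulrACA vQ mulrACA.
Qed.

(** This is [dgz_linear_change] over the ring [{poly K}]. *)
Lemma line_eval_change (A : 'M[F]_3) u w : A \in unitmx ->
  line_eval iota (dgz F) (u *m map_mx iota A) (w *m map_mx iota A) =
    line_eval iota (dgz F) u w.
Proof.
move=> Au; rewrite /line_eval -[RHS](dgz_linear_change _ _ Au).
apply: eq_mmap => // i; rewrite /linear_change !mxE !rmorph_sum /=.
rewrite mulr_suml -big_split /=; apply: eq_bigr => j _.
by rewrite !mxE !rmorphM /=; ring.
Qed.

End FixedField.

(** * Zeros of [D2] and lines defined over F_q *)

Section MooreVanishing.

Variables (F : finFieldType) (K : fieldType) (iota : {rmorphism F -> K}).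
Let q := #|F|.
Let q_gt0 : (0 < q)%N. Proof. exact/ltnW/finNzRing_gt1. Qed.
Let qK : [pchar K].-nat q. Proof. exact: pnat_card_rmorph iota. Qed.

Lemma line_poly_eq0 (x y : K) : x != 0 -> line_poly q x y = 0 ->
  exists a, y = iota a * x.
Proof.
move=> x0 xy0; have [|a aE] := @finField_fixedP F K iota (y / x); last first.
  by exists a; rewrite -aE divfK.
have := line_polyE q_gt0 x y; rewrite xy0 mulr0 => /esym/eqP; rewrite subr_eq0 => /eqP E.
rewrite expr_div_n; apply/eqP; rewrite eqr_div ?expf_neq0 //.
by rewrite mulrC E mulrC.
Qed.

Lemma line_polyBl (x y y' : K) a :
  line_poly q x (y - iota a * y') = line_poly q x y - iota a * line_poly q x y'.
Proof.
rewrite /line_poly exprDn_pchar // exprNn_pchar // exprMn -rmorphXn expf_card.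
by ring.
Qed.

(** Moore's criterion. The three factors are examined in turn; for the last, additivity of
    [L = line_poly q x] turns [L z = a L y] into [L (z - a y) = 0]. *)
Lemma moore_det2_eq0 (x y z : K) : moore_det q 2 x y z = 0 ->
  exists a b c : F, [|| a != 0, b != 0 | c != 0] /\
    iota a * x + iota b * y + iota c * z = 0.
Proof.
rewrite moore_det2E // => /eqP; rewrite !mulf_eq0.
have [-> _|x0 /=] := eqVneq x 0.
  by exists 1, 0, 0; rewrite oner_eq0 !rmorph0 !(mulr0, mul0r, addr0).
have [/(line_poly_eq0 x0)[a ->] _|xy0 /eqP] := eqVneq (line_poly q x y) 0.
  exists (- a), 1, 0; rewrite oner_eq0 orbT.
  by rewrite !(rmorph0, rmorph1, rmorphN); split => //; ring.
case/(line_poly_eq0 xy0) => a /eqP; rewrite -subr_eq0 -line_polyBl => /eqP.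
case/(line_poly_eq0 x0) => b /eqP; rewrite subr_eq => /eqP ->.
exists (- b), (- a), 1; rewrite oner_eq0 !orbT; split => //.
by rewrite !rmorphN rmorph1; ring.
Qed.

Lemma rational_line_change (v : 'rV[K]_3) : moore_det q 2 (v 0 1) (v 0 2) (v 0 0) = 0 ->
  exists2 A : 'M[F]_3, A \in unitmx & (v *m map_mx iota A) 0 0 = 0.
Proof.
case/moore_det2_eq0 => a [b [c [abc0 E]]].
(* Coordinate 0 is the third argument of the determinant, so [c] comes first. *)
pose l : 'cV[F]_3 := \col_i [:: c; a; b]`_i.
have l0 : l != 0.
  apply: contraTneq abc0 => /colP l0.
  have := (l0 0, l0 1, l0 2); rewrite !mxE /= => -[[-> ->] ->].
  by rewrite eqxx.
have vl : v *m map_mx iota l = 0.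
  apply/rowP => k; rewrite !mxE !big_ord_recl big_ord0 !mxE /= -[RHS]E.
  have -> : lift ord0 ord0 = 1 :> 'I_3 by apply: val_inj.
  have -> : lift ord0 (lift ord0 ord0) = 2 :> 'I_3 by apply: val_inj.
  by ring.
have rl : \rank l = 1%N.
  by apply/eqP; rewrite eqn_leq rank_leq_col lt0n mxrank_eq0.
(* As [l] has rank 1, it is proportional to the first column of this matrix. *)
exists (col_ebase l); first exact: col_ebase_unit.
move: vl; rewrite -{1}(mulmx_ebase l) rl !map_mxM /= map_pid_mx !mulmxA.
move/(congr1 (mulmx^~ (invmx (map_mx iota (row_ebase l))))).
rewrite mulmxK ?mul0mx ?map_unitmx ?row_ebase_unit // => /rowP/(_ 0).
rewrite !mxE (bigD1 ord0) //= big1 ?addr0 => [|i i0]; last first.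
  by rewrite !mxE /= andbC; case: i i0 => [[]] // *; rewrite mulr0.
by rewrite !mxE mulr1.
Qed.

End MooreVanishing.

Lemma dvdX2_horner0 (K : fieldType) (p : {poly K}) :
  'X^2 %| p -> p.[0] = 0 /\ p^`().[0] = 0.
Proof. by case/dvdpP => r ->; rewrite !derivE !hornerE /= !mulr0 mul0r addr0. Qed.

(** * Singular points of the curve *)

Section SingularPoints.

Variables (F : finFieldType) (K : fieldType) (iota : {rmorphism F -> K}).
Let q := #|F|.
Let q_gt1 : (1 < q)%N. Proof. exact: finNzRing_gt1. Qed.
Let q_gt0 : (0 < q)%N. Proof. exact: ltnW. Qed.
Let qK : [pchar K].-nat q. Proof. exact: pnat_card_rmorph iota. Qed.
Implicit Types (u v w : 'rV[K]_3).

Lemma natr_card_rmorph : q%:R = 0 :> K.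
Proof.
have [p _ pF] := finPcharP F; have pK := rmorph_pchar iota pF.
have : q = (p ^ logn p q)%N := card_pprimeChar pF.
case: (logn p q) => [q1|k ->]; first by move: q_gt1; rewrite q1.
by rewrite natrX (pcharf0 pK) expr0n.
Qed.

(** The columns of first and q^2-th powers are proportional, so all their minors vanish in the
    expansion along the column of q-th powers. *)
Lemma frobenius_fixed_moore_det2 v : frobenius_fixed (q ^ 2) v ->
  moore_det q 2 (v 0 1) (v 0 2) (v 0 0) = 0.
Proof.
move=> vq; rewrite /moore_det.
transitivity (v 0 1 ^+ q * (v 0 2 ^+ (q ^ 2) * v 0 0 - v 0 2 * v 0 0 ^+ (q ^ 2))
  - v 0 2 ^+ q * (v 0 1 ^+ (q ^ 2) * v 0 0 - v 0 1 * v 0 0 ^+ (q ^ 2))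
  - v 0 0 ^+ q * (v 0 1 * v 0 2 ^+ (q ^ 2) - v 0 1 ^+ (q ^ 2) * v 0 2)).
  by ring.
by rewrite (vq 1 2) (vq 1 0) (vq 2 0) !subrr !mulr0 !subr0.
Qed.

(* Along the line [u + t w] only the column of first powers of the numerator
   depends on [t] modulo [t^2], so the derivative is a linear form in [w] whose
   coefficients are the q-th powers of the entries of u x u^(q^2). *)
Lemma singular_moore_det2 u i : u 0 i != 0 ->
    (forall w, w 0 i = 0 -> 'X^2 %| line_eval iota (dgz F) u w) ->
  moore_det q 2 (u 0 1) (u 0 2) (u 0 0) = 0.
Proof.
move=> ui0 sing.
pose c : 'rV[K]_3 := \row_j
  [:: u 0 1 ^+ q * u 0 2 ^+ (q ^ 3) - u 0 1 ^+ (q ^ 3) * u 0 2 ^+ q;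
      u 0 2 ^+ q * u 0 0 ^+ (q ^ 3) - u 0 2 ^+ (q ^ 3) * u 0 0 ^+ q;
      u 0 0 ^+ q * u 0 1 ^+ (q ^ 3) - u 0 0 ^+ (q ^ 3) * u 0 1 ^+ q]`_j.
have sumE w : \sum_j w 0 j * c 0 j =
    w 0 0 * c 0 0 + w 0 1 * c 0 1 + w 0 2 * c 0 2.
  rewrite !big_ord_recl big_ord0 addr0 addrA.
  have -> : lift ord0 ord0 = 1 :> 'I_3 by apply: val_inj.
  by have -> : lift ord0 (lift ord0 ord0) = 2 :> 'I_3 by apply: val_inj.
have lin w : w 0 i = 0 ->
    \sum_j u 0 j * c 0 j = 0 /\ \sum_j w 0 j * c 0 j = 0.
  move=> wi; pose h j : {poly K} := (u 0 j)%:P + (w 0 j)%:P * 'X.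
  have hX j k : ((h j) ^+ (q ^ k.+1))^`() = 0.
    have q0 : q%:R = 0 :> {poly K} by rewrite -polyC_natr natr_card_rmorph.
    by rewrite deriv_exp -mulr_natr expnS natrM q0 mul0r mulr0.
  have hX1 j : ((h j) ^+ q)^`() = 0 by rewrite -(hX j 0%N) expn1.
  have h0 j : (h j).[0] = u 0 j.
    by rewrite /h !(hornerC, hornerD, hornerM, hornerX) mulr0 addr0.
  have h'0 j : (h j)^`().[0] = w 0 j.
    rewrite /h derivD derivM !derivC derivX.
    by rewrite !(hornerC, hornerD, hornerM, mul0r, add0r, mulr1).
  have : 'X^2 %| moore_det q 3 (h 1) (h 2) (h 0).
    by rewrite -(mmap_dgz_D2 (polyC \o iota)) dvdp_mulr ?sing.
  clearbody h; case/dvdX2_horner0; rewrite /moore_det !(derivD, derivN, derivM, hX, hX1).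
  rewrite !(hornerD, hornerN, hornerM, horner_exp, horner0, h0, h'0) => U W.
  rewrite !sumE !mxE /=; split; [rewrite -[RHS]U | rewrite -[RHS]W]; ring.
(* The directions [e_k] with [k != i] give [c_k = 0]; the vanishing of [D1] at [u], obtained with
   direction 0, then reduces to [u_i c_i = 0]. *)
have c0 j : c 0 j = 0.
  have cj k : k != i -> c 0 k = 0.
    move=> ki; have [|_] := lin (delta_mx 0 k).
      by rewrite mxE eq_sym (negPf ki) andbF.
    rewrite (bigD1 k) //= big1 ?addr0 => [|l lk]; first by rewrite mxE !eqxx mul1r.
    by rewrite mxE (negPf lk) andbF mul0r.
  have [->|/cj //] := eqVneq j i.
  have [|+ _] := lin 0; first by rewrite mxE.
  rewrite (bigD1 i) //= big1 => [|k /cj->]; last by rewrite mulr0.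
  by move/eqP; rewrite addr0 mulf_eq0 (negPf ui0) => /eqP.
apply: frobenius_fixed_moore_det2.
(* The left side is the q-th power of the difference of the two sides of the conclusion. *)
have frE a b : u 0 a ^+ q * u 0 b ^+ (q ^ 3) - u 0 a ^+ (q ^ 3) * u 0 b ^+ q = 0 ->
    u 0 a * u 0 b ^+ (q ^ 2) = u 0 a ^+ (q ^ 2) * u 0 b.
  rewrite (expnSr q 2) !exprM -!exprMn -exprNn_pchar // -exprDn_pchar // => /eqP.
  by rewrite expf_eq0 q_gt0 subr_eq0 => /eqP.
have := (c0 0, c0 1, c0 2); rewrite !mxE /= => -[[/frE E12 /frE E20] /frE E01].
have I3 (a : 'I_3) : [|| a == 0, a == 1 | a == 2] by case: a => [[|[|[]]]].
move=> a b; case/or3P: (I3 a) => /eqP ->; case/or3P: (I3 b) => /eqP -> //.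
all: by rewrite mulrC -?E12 -?E20 -?E01 // mulrC.
Qed.

(** Exactly one summand of [moore_ratio] survives: the second if [x = 0], the first otherwise. *)
Lemma moore_ratio_neq0 (x y : K) : (x != 0) || (y != 0) ->
  x * line_poly q x y = 0 -> moore_ratio q x y != 0.
Proof.
have q1 : (0 < q.-1)%N by rewrite -subn1 subn_gt0.
rewrite /moore_ratio; have [->|x0 _] /= := eqVneq x 0 => [y0 _|/eqP].
  rewrite /line_poly !expr0n muln_eq0 (gtn_eqF q_gt0) (gtn_eqF q1).
  by rewrite mul0r subr0 add0r !expf_neq0.
rewrite mulf_eq0 (negPf x0) => /eqP ->.
by rewrite expr0n (gtn_eqF q1) addr0 expf_neq0.
Qed.

Lemma frobenius_fixed_line Q v : (0 < Q)%N -> v 0 0 = 0 ->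
  frobenius_fixed Q v <-> v 0 1 * v 0 2 ^+ Q = v 0 1 ^+ Q * v 0 2.
Proof.
move=> Q0 v0; split=> [-> //|E].
have I3 (a : 'I_3) : [|| a == 0, a == 1 | a == 2] by case: a => [[|[|[]]]].
move=> a b; case/or3P: (I3 a) => /eqP ->; case/or3P: (I3 b) => /eqP ->;
  rewrite ?v0 ?expr0n ?(gtn_eqF Q0) ?mul0r ?mulr0 //.
all: by rewrite mulrC // -E mulrC.
Qed.

(* On the line z = 0 the curve is cut out by the q-th power of [moore_ratio]. *)
Lemma moore_ratio_eq0 v : v != 0 -> v 0 0 = 0 ->
  moore_ratio q (v 0 1) (v 0 2) = 0 <->
  frobenius_fixed (q ^ 2) v /\ ~ frobenius_fixed q v.
Proof.
move=> vn0 v0; have := moore_ratioE q_gt0 qK (v 0 1) (v 0 2).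
rewrite !frobenius_fixed_line ?expn_gt0 ?q_gt0 // => E.
split=> [T0|[E2 E1]].
  split=> [|E1]; first by apply/eqP; rewrite -subr_eq0 -E T0 mulr0.
  suff : moore_ratio q (v 0 1) (v 0 2) != 0 by rewrite T0 eqxx.
  apply: moore_ratio_neq0; last by rewrite line_polyE // E1 subrr.
  apply: contraNT vn0; rewrite negb_or !negbK => /andP[/eqP v1 /eqP v2].
  apply/eqP/rowP => j; rewrite mxE; case: j => [[|[|[|//]]] lj].
  - by rewrite -[RHS]v0; congr (v 0 _); apply: val_inj.
  - by rewrite -[RHS]v1; congr (v 0 _); apply: val_inj.
  - by rewrite -[RHS]v2; congr (v 0 _); apply: val_inj.
move/eqP: E; rewrite E2 subrr mulf_eq0 => /orP[|/eqP //].
by rewrite line_polyE // subr_eq0 => /eqP.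
Qed.

Lemma frobenius_fixed_changeE e (A : 'M[F]_3) v : A \in unitmx ->
  frobenius_fixed (q ^ e) (v *m map_mx iota A) <-> frobenius_fixed (q ^ e) v.
Proof.
move=> Au; split; last exact: frobenius_fixed_change.
move/(@frobenius_fixed_change _ _ iota e (invmx A) _).
by rewrite map_invmx mulmxK // map_unitmx.
Qed.

Lemma dgz_line_eval0 v : line_eval iota (dgz F) v 0 = (mmap iota (v 0) (dgz F))%:P.
Proof.
rewrite -[RHS]/(polyC _) rmorph_mmap; apply: eq_mmap => // j /=.
by rewrite mxE mul0r addr0.
Qed.

Lemma singular_frobenius_fixed u i : u 0 i != 0 ->
    (forall w, w 0 i = 0 -> 'X^2 %| line_eval iota (dgz F) u w) ->
  frobenius_fixed (q ^ 2) u /\ ~ frobenius_fixed q u.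
Proof.
move=> ui0 sing; have un0 : u != 0 by apply: contraNneq ui0 => ->; rewrite mxE.
have [A Au uA0] := rational_line_change iota (singular_moore_det2 ui0 sing).
have iA : map_mx iota A \in unitmx by rewrite map_unitmx.
rewrite -(frobenius_fixed_changeE 2 u Au) -{2}(expn1 q).
rewrite -(frobenius_fixed_changeE 1 u Au) expn1.
apply/moore_ratio_eq0 => //.
  by apply: contraNneq un0 => uA; rewrite -(mulmxK iA u) uA mul0mx.
(* Direction 0 makes the line constant, so only the vanishing of [F] at [u] remains. *)
have := sing 0; rewrite mxE => /(_ erefl).
rewrite -(line_eval_change iota u 0 Au) mul0mx dgz_line_eval0.
case/dvdX2_horner0; rewrite hornerC mmap_dgzE uA0 => + _.
rewrite /plane_poly line_polyx0 // line_polyx0 // expr0n -subn1 subn_eq0.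
rewrite leqNgt q_gt1 add0r.
by move/eqP; rewrite expf_eq0 => /andP[_ /eqP].
Qed.

(** After a change of coordinates, both summands of [F] are powers of polynomials vanishing at
    parameter 0, with exponents [q - 1] and [q]; the bound on [q] makes both at least 2. *)
Lemma frobenius_fixed_singular v w : (2 < q)%N -> v != 0 ->
    frobenius_fixed (q ^ 2) v -> ~ frobenius_fixed q v ->
  'X^2 %| line_eval iota (dgz F) v w.
Proof.
move=> q_gt2 vn0 v2 v1.
have [A Au vA0] := rational_line_change iota (frobenius_fixed_moore_det2 v2).
rewrite -(line_eval_change iota v w Au) /line_eval mmap_dgzE -/q.
set v' := v *m _ in vA0 *; set w' := w *m _.
have v'n0 : v' != 0.
  have iA : map_mx iota A \in unitmx by rewrite map_unitmx.
  by apply: contraNneq vn0 => vA; rewrite -(mulmxK iA v) -/v' vA mul0mx.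
have T0 : moore_ratio q (v' 0 1) (v' 0 2) = 0.
  apply/moore_ratio_eq0 => //; rewrite frobenius_fixed_changeE //; split=> //.
  by rewrite -(expn1 q) frobenius_fixed_changeE // expn1.
have X_dvd (p : {poly K}) e : p.[0] = 0 -> (2 <= e)%N -> 'X^2 %| p ^+ e.
  move=> p0 e2; apply: dvdp_trans (dvdp_exp2l p e2); apply: dvdp_exp2r.
  by rewrite -['X]subr0 -polyC0 dvdp_XsubCl; apply/rootP.
have h0 j : horner_eval 0 ((v' 0 j)%:P + (w' 0 j)%:P * 'X) = v' 0 j.
  by rewrite /horner_eval !(hornerC, hornerD, hornerM, hornerX) mulr0 addr0.
apply: dvdp_add; apply: X_dvd; rewrite ?(ltnW q_gt2) -?subn1 ?leq_subRL ?(ltnW q_gt2) //.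
  rewrite -[LHS]/(horner_eval 0 _) rmorph_plane_poly /= !h0 vA0 /plane_poly.
  by rewrite !line_polyx0.
by rewrite -[LHS]/(horner_eval 0 _) rmorph_moore_ratio /= !h0.
Qed.

End SingularPoints.

(* Fq and Fq2 are the fields with q and q^2 elements, K is an algebraic closure
   of Fq (via iota), and Fq2 is embedded in K by jota. *)
Theorem lemma4p5 (p n q : nat) (p_prime : prime p) (q_pow : q = (p ^ n)%N)
    (q_ge3 : (3 <= q)%N)
    (Fq Fq2 : finFieldType) (card_Fq : #|Fq| = q) (card_Fq2 : #|Fq2| = (q ^ 2)%N)
    (K : closedFieldType) (iota : {rmorphism Fq -> K})
    (K_alg : forall x : K, algebraicOver iota x)
    (jota : {rmorphism Fq2 -> K})
    (v : 'rV[K]_3) (v_neq0 : v != 0) :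
  singular_point (map_mpoly iota (dgz Fq)) v <->
  in_PG2 jota v /\ ~ in_PG2 iota v.
Proof.
subst q; rewrite (in_PG2P jota v_neq0) (in_PG2P iota v_neq0) card_Fq2 -card_Fq.
have q_gt2 : (2 < #|Fq|)%N by rewrite card_Fq.
rewrite /singular_point /on_curve /multiplicity meval_map_mpoly.
case: pickP => [i vi | v0]; last first.
  by case/rV0Pn: v_neq0 => i; rewrite v0.
(* The chart uses the representative with i-th coordinate 1, while the Frobenius conditions are
   insensitive to scaling. *)
have uZ : v = v 0 i *: ((v 0 i)^-1 *: v) by rewrite scalerA mulfV ?scale1r.
have ui : ((v 0 i)^-1 *: v) 0 i != 0 by rewrite mxE mulVf ?oner_eq0.
split=> [[_ /(mpoly_order_local_dgz iota vi)]|[v2 v1]].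
  case/(singular_frobenius_fixed ui) => u2 u1.
  split=> [|v1]; first by rewrite uZ; exact: frobenius_fixedZ.
  exact/u1/frobenius_fixedZ.
split.
  have := frobenius_fixed_singular iota 0 q_gt2 v_neq0 v2 v1.
  by rewrite dgz_line_eval0 => /dvdX2_horner0[+ _]; rewrite hornerC.
apply/(mpoly_order_local_dgz iota vi) => w _.
apply: frobenius_fixed_singular => //; first by apply: contraNneq ui => ->; rewrite mxE.
  exact: frobenius_fixedZ.
by move=> /(frobenius_fixedZ (v 0 i)); rewrite -uZ.
Qed.
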